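(* Let $E$ be a real Hausdorff locally convex topological vector space, let $P\subset E$ be a proper, closed, convex, pointed cone with nonempty interior, and let $e\in \operatorname{int}P$. Let $(X,p)$ be a TVS-cone metric space with $p:X\times X\to E$ (with respect to $P$), let $x\in X$ and let $\{x_n\}_{n=1}^{\infty}$ be a sequence in $X$. Set $d_p=\xi_e\circ p$, where $\xi_e(y)=\inf\{r\in\mathbb{R}: y\in re-P\}$ for $y\in E$. Then the following statements hold: (i) $\{x_n\}_{n=1}^{\infty}$ converges to $x$ in the TVS-cone metric space $(X,p)$ if and only if $d_p(x_n,x)\to 0$ as $n\to\infty$; (ii) $\{x_n\}_{n=1}^{\infty}$ is a Cauchy sequence in the TVS-cone metric space $(X,p)$ if and only if $\{x_n\}_{n=1}^{\infty}$ is a Cauchy sequence (in the usual sense) in $(X,d_p)$; (iii) $(X,p)$ is a complete TVS-cone metric space if and only if $(X,d_p)$ is a complete metric space.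
   Context: Let $E$ be a real Hausdorff locally convex topological vector space with zero vector $\theta$. A nonempty set $P\subset E$ is a convex cone if $P+P\subset P$ and $\lambda P\subset P$ for all $\lambda\ge 0$; it is pointed if $P\cap(-P)=\{\theta\}$, and proper if $P\neq E$. Given such a $P$, write $u\le v$ if $v-u\in P$, and $u\ll v$ if $v-u\in\operatorname{int}P$ (the topological interior of $P$). A TVS-cone metric space (TVS-CMS) is a pair $(X,p)$ with $X$ a nonempty set and $p:X\times X\to E$ satisfying, for all $x,y,z\in X$: (C1) $\theta\le p(x,y)$, and $p(x,y)=\theta$ if and only if $x=y$; (C2) $p(x,y)=p(y,x)$; (C3) $p(x,z)\le p(x,y)+p(y,z)$. A sequence $\{x_n\}$ in $X$ converges to $x\in X$ in $(X,p)$ if for every $c\in E$ with $\theta\ll c$ there is $n_0\in\mathbb{N}$ such that $p(x_n,x)\ll c$ for all $n\ge n_0$. It is Cauchy in $(X,p)$ if for every $c\in E$ with $\theta\ll c$ there is $n_0\in\mathbb{N}$ such that $p(x_n,x_m)\ll c$ for all $n,m\ge n_0$. $(X,p)$ is complete if every Cauchy sequence in $(X,p)$ converges in $(X,p)$ to some point of $X$. The nonlinear scalarization function is $\xi_e:E\to\mathbb{R}$, $\xi_e(y)=\inf\{r\in\mathbb{R}: y\in re-P\}$. It is a known fact that $d_p=\xi_e\circ p: X\times X\to[0,\infty)$ is a metric on $X$ in the usual sense. *)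

(* Defs.v *)
From HB Require Import structures.
From mathcomp Require Import all_boot all_order all_algebra.
From mathcomp Require Import all_classical all_reals all_analysis.
From mathcomp Require Import ring lra.

Set Implicit Arguments.
Unset Strict Implicit.
Unset Printing Implicit Defensive.

Import Order.TTheory GRing.Theory Num.Theory.
Import numFieldNormedType.Exports.
Local Open Scope classical_set_scope.
Local Open Scope ring_scope.

(* [tvsType R] includes local convexity but no separation axiom: Hausdorff spaces
   are those satisfying [hausdorff_space E]. *)
Record convex_cone (R : realType) (E : tvsType R) (P : set E) : Prop := {
  cone_neq0 : P !=set0 ;
  coneD : forall u v, P u -> P v -> P (u + v) ;
  coneZ : forall (a : R) u, 0 <= a -> P u -> P (a *: u) }.

Record ordering_cone (R : realType) (E : tvsType R) (P : set E) : Prop := {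
  ocone_convex : convex_cone P ;
  ocone_pointed : P `&` [set - u | u in P] = [set 0] ;
  ocone_proper : P <> setT ;
  ocone_closed : closed P ;
  ocone_solid : P° !=set0 }.

Definition cone_le (R : realType) (E : tvsType R) (P : set E) (u v : E) : Prop :=
  P (v - u).

Definition cone_ll (R : realType) (E : tvsType R) (P : set E) (u v : E) : Prop :=
  P° (v - u).

Record tvs_cone_metric (R : realType) (E : tvsType R) (P : set E)
    (X : Type) (p : X -> X -> E) : Prop := {
  cmetric_inhabited : inhabited X ;
  cmetric_ge0 : forall x y, cone_le P 0 (p x y) ;
  cmetric_eq0 : forall x y, p x y = 0 <-> x = y ;
  cmetric_sym : forall x y, p x y = p y x ;
  cmetric_triangle : forall x y z, cone_le P (p x z) (p x y + p y z) }.

Section ConeSequences.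
Context (R : realType) (E : tvsType R) (P : set E) (X : Type) (p : X -> X -> E).

Definition cone_cvg (u : nat -> X) (l : X) : Prop :=
  forall c : E, cone_ll P 0 c ->
  exists n0 : nat, forall n, (n0 <= n)%N -> cone_ll P (p (u n) l) c.

Definition cone_cauchy (u : nat -> X) : Prop :=
  forall c : E, cone_ll P 0 c ->
  exists n0 : nat, forall n m, (n0 <= n)%N -> (n0 <= m)%N ->
    cone_ll P (p (u n) (u m)) c.

Definition cone_complete : Prop :=
  forall u : nat -> X, cone_cauchy u -> exists l : X, cone_cvg u l.

End ConeSequences.

(* [inf] is total: it returns the greatest lower bound only when the set is
   nonempty and bounded below, as is the case for [y] in [P] by
   [scal_dom_has_inf]. *)
Definition scalarization (R : realType) (E : tvsType R) (P : set E) (e : E)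
    (y : E) : R :=
  inf [set r : R | [set r *: e - q | q in P] y].

Definition scalar_dist (R : realType) (E : tvsType R) (P : set E) (e : E)
    (X : Type) (p : X -> X -> E) (x y : X) : R :=
  scalarization P e (p x y).

(* Nonnegativity of [d] follows from these axioms (it is [mdist_ge0] for the
   [metricType] built below). *)
Record is_metric (R : realType) (X : Type) (d : X -> X -> R) : Prop := {
  dist_eq0 : forall x, d x x = 0 ;
  eq0_dist : forall x y, d x y = 0 -> x = y ;
  dist_sym : forall x y, d x y = d y x ;
  dist_triangle : forall y x z, d x z <= d x y + d y z }.

Definition metric_carrier (R : realType) (X : Type) (d : X -> X -> R)
  (dm : is_metric d) : Type := X.

Section MetricCarrier.
Context (R : realType) (X : Type) (d : X -> X -> R) (dm : is_metric d).

HB.instance Definition _ := gen_eqMixin (metric_carrier dm).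
HB.instance Definition _ := gen_choiceMixin (metric_carrier dm).
HB.instance Definition _ := isMetric.Build R (metric_carrier dm)
  (dist_eq0 dm) (eq0_dist dm) (dist_sym dm) (dist_triangle dm).

End MetricCarrier.

(* The pair (X, d) as a [metricType]: its distance is [d], its topology and
   uniformity are those generated by the balls [set y | d x y < r]. *)
Definition metric_space (R : realType) (X : Type) (d : X -> X -> R)
  (dm : is_metric d) : metricType R := metric_carrier dm.

Definition cauchy_seq (R : realType) (M : metricType R) (u : nat -> M) : Prop :=
  cauchy (u @ \oo).
Arguments cauchy_seq {R} M u.

Definition seq_complete (R : realType) (M : metricType R) : Prop :=
  forall u : nat -> M, cauchy_seq M u -> exists l : M, u @ \oo --> l.
Arguments seq_complete {R} M.

Lemma metric_space_mdistE (R : realType) (X : Type) (d : X -> X -> R)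
  (dm : is_metric d) (x y : metric_space dm) : mdist x y = d x y.
Proof. by []. Qed.

Lemma metric_space_cauchyP (R : realType) (X : Type) (d : X -> X -> R)
    (dm : is_metric d) (u : nat -> X) :
  cauchy_seq (metric_space dm) u <->
  forall eps : R, 0 < eps ->
    exists n0 : nat, forall n m, (n0 <= n)%N -> (n0 <= m)%N ->
      d (u n) (u m) < eps.
Proof.
split=> [/cauchy_ballP cu eps eps0|cu].
  have [[A B] /= [[a _ aA] [b _ bB]] AB] := cu _ eps0.
  exists (maxn a b) => n m; rewrite !geq_max => /andP[an _] /andP[_ bm].
  by have := AB (u n, u m) (conj (aA n an) (bB m bm)); rewrite /= ballEmdist.
apply/cauchy_ballP => eps eps0; have [n0 un0] := cu _ eps0.
exists ([set u n | n in [set n | (n0 <= n)%N]],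
        [set u n | n in [set n | (n0 <= n)%N]]).
  by split; exists n0 => // n n0n; exists n.
move=> [_ _] /= [[n n0n <-] [m n0m <-]].
by rewrite ballEmdist; exact: un0.
Qed.

Lemma metric_space_cvgP (R : realType) (X : Type) (d : X -> X -> R)
    (dm : is_metric d) (u : nat -> X) (l : X) :
  (u : nat -> metric_space dm) @ \oo --> (l : metric_space dm) <->
  d (u n) l @[n --> \oo] --> (0 : R).
Proof.
have d0 x y : `|0 - d x y| = d x y.
  by rewrite sub0r normrN ger0_norm//; exact: (@mdist_ge0 R (metric_space dm)).
split=> [/cvg_ballP ul|/cvgrPdist_lt ul].
  apply/cvgrPdist_lt => eps eps0; near=> n.
  by rewrite d0 (dist_sym dm); near: n; have := ul _ eps0; rewrite ballEmdist.
apply/cvg_ballP => eps eps0; near=> n; rewrite ballEmdist /=.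
by rewrite metric_space_mdistE (dist_sym dm) -d0; near: n; exact: ul.
Unshelve. all: by end_near. Qed.

Section ScalarDistMetric.
Context (R : realType) (E : tvsType R) (P : set E) (e : E).
Hypotheses (Pc : ordering_cone P) (eP : P° e).

Lemma scal_domE (y : E) :
  [set r : R | [set r *: e - q | q in P] y] = [set r : R | P (r *: e - y)].
Proof.
apply/seteqP; split=> r /=.
  by move=> [q Pq <-]; rewrite opprB addrC subrK.
by move=> Pr; exists (r *: e - y); rewrite // opprB addrC subrK.
Qed.

Lemma cvg_subE (T : Type) (F : set_system T) {FF : Filter F} (f g : T -> E)
    (a b : E) : f @ F --> a -> g @ F --> b -> (fun t => f t - g t) @ F --> a - b.
Proof.
move=> fa gb.
apply: (@cvg_comp _ _ _ (fun t => (f t, g t)) (fun z : E * E => z.1 - z.2) F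
  (nbhs (a, b))); last exact: (@sub_continuous E (a, b)).
exact: cvg_pair.
Qed.

Lemma cvg_scalel (y : E) (a : R) : (fun t : R => t *: y) @ a --> a *: y.
Proof.
apply: (@cvg_comp _ _ _ (fun t : R => (t : R^o, y)) (fun z : R^o * E => z.1 *: z.2)
  (nbhs a) (nbhs (a : R^o, y))); last exact: (scale_continuous (a : R^o, y)).
by apply: (@cvg_pair _ _ _ _ (nbhs (a : R^o))); [exact: cvg_id|exact: cvg_cst].
Qed.

Lemma scal_dom_neq0 (y : E) : [set r : R | P (r *: e - y)] !=set0.
Proof.
have cf : (fun t : R => e - t *: y) @ (0 : R) --> e - 0 *: y.
  apply: cvg_subE; [exact: cvg_cst|exact: cvg_scalel].
have /cf /= : nbhs (e - 0 *: y) P by rewrite scale0r subr0.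
rewrite -[X in X -> _]/(nbhs (0 : R) [set t : R | P (e - t *: y)]).
move=> /nbhs_ballP[d /= d0 dP].
have t0 : 0 < d / 2 by rewrite divr_gt0.
have /dP /= Pt : ball (0 : R) d (d / 2).
  by rewrite /ball /= sub0r normrN gtr0_norm// ltr_pdivrMr// ltr_pMr// ltr1n.
exists (d / 2)^-1 => /=.
have := coneZ (ocone_convex Pc) (ltW (_ : 0 < (d / 2)^-1)) Pt.
by rewrite invr_gt0 => /(_ t0); rewrite scalerBr scalerA mulVf ?scale1r ?gt_eqF.
Qed.

Lemma cone0 : P 0.
Proof.
have [u Pu] := cone_neq0 (ocone_convex Pc).
by rewrite -(scale0r u); exact: coneZ (ocone_convex Pc) _ _ (lexx 0) Pu.
Qed.

Lemma scal_dom_lb (y : E) : P y -> lbound [set r : R | P (r *: e - y)] 0.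
Proof.
move=> Py r /= Pr; rewrite leNgt; apply/negP => r0; apply: (ocone_proper Pc).
have Pe : P e := interior_subset eP.
have Pre : P (r *: e) by rewrite -(subrK y (r *: e)); exact: coneD (ocone_convex Pc) _ _ Pr Py.
have PNe : P (- e).
  have := coneZ (ocone_convex Pc) (ltW (_ : 0 < - r^-1)) Pre.
  rewrite oppr_gt0 invr_lt0 => /(_ r0).
  by rewrite scalerA mulNr mulVf ?lt_eqF// scaleN1r.
have e0 : e = 0.
  suff : (P `&` [set - u | u in P]) e by rewrite (ocone_pointed Pc).
  by split => //; exists (- e); rewrite ?opprK.
apply/seteqP; split => // z _.
have [r' /= ] := scal_dom_neq0 (- z).
by rewrite e0 scaler0 sub0r opprK.
Qed.

Lemma scal_dom_has_inf (y : E) : P y -> has_inf [set r : R | P (r *: e - y)].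
Proof.
by move=> Py; split; [exact: scal_dom_neq0|exists 0; exact: scal_dom_lb].
Qed.

Context (X : Type) (p : X -> X -> E) (pm : tvs_cone_metric P p).

Lemma cmetric_cone x y : P (p x y).
Proof. by have := cmetric_ge0 pm x y; rewrite /cone_le subr0. Qed.

Lemma scalar_dist_metric : is_metric (scalar_dist P e p).
Proof.
have Dc := coneD (ocone_convex Pc).
rewrite /scalar_dist /scalarization; split.
- move=> x; rewrite (cmetric_eq0 pm x x).2// scal_domE.
  apply/eqP; rewrite eq_le; apply/andP; split.
    apply: ge_inf; first by exists 0; exact: scal_dom_lb cone0.
    by rewrite /= scale0r subr0; exact: cone0.
  by apply: lb_le_inf; [exact: scal_dom_neq0|exact: scal_dom_lb cone0].
- move=> x y; rewrite scal_domE => xy0; apply/(cmetric_eq0 pm).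
  have Peps (eps : R) : 0 < eps -> P (eps *: e - p x y).
    move=> eps0.
    have [r /= Pr] := inf_adherent eps0 (scal_dom_has_inf (cmetric_cone x y)).
    rewrite xy0 add0r => reps.
    rewrite -(subrK r eps) scalerDl -addrA; apply: (Dc) => //.
    apply: (coneZ (ocone_convex Pc)); first by rewrite subr_ge0 ltW.
    exact: interior_subset eP.
  have PN : P (- p x y).
    have cf : (fun t : R => t *: e - p x y) @ (0 : R)^'+ --> 0 *: e - p x y.
      apply: cvg_at_right_filter.
      by apply: cvg_subE; [exact: cvg_scalel|exact: cvg_cst].
    rewrite scale0r sub0r in cf.
    apply: (closed_cvg P (ocone_closed Pc) _ _ cf).
    by near=> t; apply: Peps.
  suff : (P `&` [set - u | u in P]) (p x y) by rewrite (ocone_pointed Pc).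
  by split; [exact: cmetric_cone|exists (- p x y); rewrite ?opprK].
- by move=> x y; rewrite (cmetric_sym pm).
- move=> y x z; rewrite !scal_domE; apply/ler_addgt0Pl => eps eps0.
  have eps20 : 0 < eps / 2 by rewrite divr_gt0.
  have [r /= Pr rlt] := inf_adherent eps20 (scal_dom_has_inf (cmetric_cone x y)).
  have [s /= Ps slt] := inf_adherent eps20 (scal_dom_has_inf (cmetric_cone y z)).
  have rs : inf [set r : R | P (r *: e - p x z)] <= r + s.
    apply: ge_inf; first by exists 0; exact: scal_dom_lb (cmetric_cone x z).
    have := Dc _ _ (Dc _ _ Pr Ps) (cmetric_triangle pm x y z).
    rewrite /= scalerDl.
    rewrite (_ : _ + _ + _ = r *: e + s *: e - p x z)//.
    by rewrite [X in X + _]addrACA -opprD addrA subrK.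
  by move: rs rlt slt; lra.
Unshelve. all: by end_near. Qed.

End ScalarDistMetric.

(* Main.v *)
(* On [P], the scalarization satisfies [xi_e y < r] iff [y << r e], and each
   [c >> 0] dominates some [eps e] with [eps > 0]; so testing smallness of [p]
   against all [c >> 0] amounts to testing [d_p] against all [eps > 0]. *)
Require Import Defs.
From mathcomp Require Import all_boot all_order all_algebra.
From mathcomp Require Import all_classical all_reals all_analysis.
Set Implicit Arguments.
Unset Strict Implicit.
Unset Printing Implicit Defensive.
Import Order.TTheory GRing.Theory Num.Theory.
Import numFieldNormedType.Exports.
Local Open Scope classical_set_scope.
Local Open Scope ring_scope.

Section InteriorCone.
Context (R : realType) (E : tvsType R) (P : set E).
Hypothesis Pc : convex_cone P.

(** Translation by [v] is continuous and maps [P] into [P], so it carries a neighbourhood of [u]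
    inside [P] to one of [u + v] inside [P]. *)
Lemma interior_coneD (u v : E) : P° u -> P v -> P° (u + v).
Proof.
move=> Pu Pv.
have cf : (fun z => z - v) @ (u + v) --> u.
  by rewrite -[X in _ --> X](addrK v); apply: cvg_subE; [exact: cvg_id|exact: cvg_cst].
apply: (@filterS _ (nbhs (u + v)) _ _ P _ (cf _ Pu)) => z /= Pz.
by rewrite -(subrK v z); exact: (coneD Pc).
Qed.

(** Same argument with the homothety of ratio [a], whose inverse is continuous. *)
Lemma interior_coneZ (a : R) (u : E) : 0 < a -> P° u -> P° (a *: u).
Proof.
move=> a0 Pu.
have cf : (fun z : E => a^-1 *: z) @ (a *: u) --> u.
  rewrite -[X in _ --> X](scalerK (lt0r_neq0 a0)).
  apply: (@cvg_comp _ _ _ (fun z : E => (a^-1 : R^o, z))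
    (fun z : R^o * E => z.1 *: z.2) _ (nbhs (a^-1 : R^o, a *: u))).
    by apply: (@cvg_pair _ _ _ _ (nbhs (a^-1 : R^o))); [exact: cvg_cst|exact: cvg_id].
  exact: (scale_continuous (a^-1 : R^o, a *: u)).
apply: (@filterS _ (nbhs (a *: u)) _ _ P _ (cf _ Pu)) => z /= Pz.
by rewrite -(scalerKV (lt0r_neq0 a0) z); exact: (coneZ Pc (ltW a0)).
Qed.

(** The points [c - t *: e] tend to [c] as [t] decreases to 0, so they enter the open set [P°]; the
    right-sided filter supplies [0 < t]. *)
Lemma interior_subZ (c e : E) : P° c ->
  exists2 eps : R, 0 < eps & P° (c - eps *: e).
Proof.
move=> cP.
have cf : (fun t : R => c - t *: e) @ (0 : R)^'+ --> c.
  apply: cvg_at_right_filter; rewrite -[X in _ --> X]subr0 -(scale0r e).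
  by apply: cvg_subE; [exact: cvg_cst|exact: cvg_scalel].
have H : \forall t \near (0 : R)^'+, 0 < t /\ P° (c - t *: e).
  by near=> t; split=> //; near: t; exact: (cf _ (nbhs_interior cP)).
by have [t [t0 Pt]] := filter_ex H; exists t.
Unshelve. all: by end_near. Qed.

End InteriorCone.

Section Scalarization.
Context (R : realType) (E : tvsType R) (P : set E) (e : E).
Hypotheses (hP : ordering_cone P) (he : P° e).

(** Strict inequality matches the interior because [e] is interior: slack in [r] becomes a positive
    multiple of [e], and conversely an interior point leaves room to lower [r]. *)
Lemma scalarization_lt (y : E) (r : R) : P y ->
  scalarization P e y < r <-> P° (r *: e - y).
Proof.
move=> Py; have Pc := ocone_convex hP.
rewrite /scalarization scal_domE; split=> [ltr|Pr].
  have [s /= Ps sr] := inf_lt (scal_dom_neq0 hP he y) ltr.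
  (* Splits [r *: e - y] as [(r - s) *: e], which is interior, plus [s *: e - y], which is in
     [P]. *)
  rewrite -(subrK s r) scalerDl -addrA; apply: interior_coneD => //.
  by apply: interior_coneZ => //; rewrite subr_gt0.
have [eps eps0 /interior_subset Peps] := interior_subZ e Pr.
(* [r - eps] is still admissible; [P y] bounds the admissible set below by 0, so its [inf] is a
   genuine lower bound. *)
apply: (@le_lt_trans _ _ (r - eps)); last by rewrite ltrBlDr ltrDl.
apply: ge_inf; first by exists 0; exact: (scal_dom_lb hP he Py).
by rewrite /= scalerBl addrAC.
Qed.

(** One [eps] serves all [y]: with [c - eps *: e] interior, add [eps *: e - y], which lies in
    [P]. *)
Lemma interior_scalarization_lt (c : E) : P° c ->
  exists2 eps : R, 0 < eps &
    forall y, P y -> scalarization P e y < eps -> P° (c - y).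
Proof.
move=> /(interior_subZ e)[eps eps0 Pceps]; exists eps => // y Py.
move=> /(scalarization_lt eps Py) /interior_subset Pepsy.
by rewrite -(subrK (eps *: e) c) -addrA; apply: (interior_coneD (ocone_convex hP)).
Qed.

Context (X : Type) (p : X -> X -> E) (hp : tvs_cone_metric P p).

Lemma cone_cvgP (u : nat -> X) (l : X) :
  cone_cvg P p u l <-> scalar_dist P e p (u n) l @[n --> \oo] --> (0 : R).
Proof.
(* Nonnegativity of the metric removes the absolute value in the real limit. *)
have d0 n : `|0 - scalar_dist P e p (u n) l| = scalar_dist P e p (u n) l.
  rewrite sub0r normrN ger0_norm//.
  exact: (@mdist_ge0 R (metric_space (scalar_dist_metric hP he hp))).
split=> [ul|/cvgrPdist_lt ul c].
  apply/cvgrPdist_lt => eps eps0.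
  (* The test vector [eps *: e] turns the cone bound into [d_p < eps]. *)
  have [|n0 un0] := ul (eps *: e).
    by rewrite /cone_ll subr0; exact: (interior_coneZ (ocone_convex hP)).
  exists n0 => // n /= /un0 ?; rewrite d0.
  exact/(scalarization_lt _ (cmetric_cone hp _ _)).
rewrite /cone_ll subr0 => /interior_scalarization_lt[eps eps0 epsc].
have [n0 _ un0] := ul _ eps0; exists n0 => n /un0; rewrite d0.
exact: epsc (cmetric_cone hp _ _).
Qed.

Lemma cone_cauchyP (u : nat -> X) :
  cone_cauchy P p u <-> cauchy_seq (metric_space (scalar_dist_metric hP he hp)) u.
Proof.
rewrite metric_space_cauchyP; split=> [cu eps eps0|cu c].
  have [|n0 un0] := cu (eps *: e).
    by rewrite /cone_ll subr0; exact: (interior_coneZ (ocone_convex hP)).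
  exists n0 => n m nn mn.
  by apply/(scalarization_lt _ (cmetric_cone hp _ _)); exact: un0.
rewrite /cone_ll subr0 => /interior_scalarization_lt[eps eps0 epsc].
have [n0 un0] := cu _ eps0; exists n0 => n m nn mn.
by apply: epsc (cmetric_cone hp _ _) _; exact: un0.
Qed.

(** Both structures have the same Cauchy sequences and the same limits; [metric_space_cvgP] links
    convergence in the metric topology to distances tending to 0. *)
Lemma cone_completeP :
  cone_complete P p <-> seq_complete (metric_space (scalar_dist_metric hP he hp)).
Proof.
split=> cX u /cone_cauchyP /cX[l ul]; exists l.
  exact/metric_space_cvgP/cone_cvgP.
exact/cone_cvgP/(metric_space_cvgP (scalar_dist_metric hP he hp)).
Qed.

End Scalarization.

Theorem theorem2 (R : realType) (E : tvsType R) (hE : hausdorff_space E)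
    (P : set E) (hP : ordering_cone P) (e : E) (he : P° e)
    (X : Type) (p : X -> X -> E) (hp : tvs_cone_metric P p)
    (x : X) (x_ : nat -> X) :
  let d_p : X -> X -> R := scalar_dist P e p in
  let X_dp : metricType R := metric_space (scalar_dist_metric hP he hp : is_metric d_p) in
  [/\ cone_cvg P p x_ x <-> d_p (x_ n) x @[n --> \oo] --> (0 : R),
      cone_cauchy P p x_ <-> cauchy_seq X_dp x_
    & cone_complete P p <-> seq_complete X_dp].
Proof.
by move=> d_p X_dp; split; [exact: cone_cvgP|exact: cone_cauchyP|exact: cone_completeP].
Qed.
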